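(* Let $\boldsymbol\lambda$ be a partition and $Y(\boldsymbol\lambda)$ its Young diagram. Then $$\prod_{x\in Y(\boldsymbol\lambda)}h(x)=\frac{1}{\Delta_{\boldsymbol\lambda}(\exp(t))},$$ where $h(x)$ denotes the hook length of the box $x$ of $Y(\boldsymbol\lambda)$.
   Context: A partition is a non-increasing sequence $\boldsymbol\lambda=(\lambda_1\ge\lambda_2\ge\cdots)$ of non-negative integers with finitely many nonzero terms; its Young diagram is the left-justified array whose $i$th row has $\lambda_i$ boxes. Schur determinant: for a formal power series $f(t)=\sum_{n\ge0}f_nt^n$ over a commutative $\mathbb Q$-algebra (with $f_n=0$ for $n<0$) and a partition $\boldsymbol\lambda$ with at most $r$ parts, $\Delta_{\boldsymbol\lambda}(f(t))=\det(f_{\lambda_j-j+i})_{1\le i,j\le r}$ (independent of the choice of such $r$). Here it is applied to $\exp(t)=\sum_{n\ge0}t^n/n!$. *)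

(* Defs.v *)
From HB Require Import structures.
From mathcomp Require Import all_boot all_order all_algebra.

Set Implicit Arguments.
Unset Strict Implicit.
Unset Printing Implicit Defensive.

Import GRing.Theory.

(* Rows, columns and parts are numbered from 0: [lam i] is lambda_(i+1). *)
Record int_partition := IntPartition {
  int_part :> nat -> nat;
  int_part_noninc : forall i, int_part i.+1 <= int_part i;
  int_part_fin : exists r, forall i, r <= i -> int_part i = 0
}.

Lemma int_part_vanishes (lam : int_partition) : exists n, lam n == 0.
Proof. by have [r lam0] := int_part_fin lam; exists r; rewrite lam0. Qed.

Lemma int_part_anti (lam : int_partition) i j : i <= j -> lam j <= lam i.
Proof.
move/subnK <-; elim: (j - i) => [//|k IHk].
by rewrite addSn (leq_trans (int_part_noninc _ _)).
Qed.

(* The number of nonzero parts, i.e. the first index carrying a zero part. *)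
Definition nparts (lam : int_partition) : nat := ex_minn (int_part_vanishes lam).

Lemma nparts_leP (lam : int_partition) r :
  nparts lam <= r <-> (forall i, r <= i -> lam i = 0).
Proof.
rewrite /nparts; case: ex_minnP => m /eqP lam_m min_m; split=> [le_mr i le_ri|lam0].
  by apply/eqP; rewrite -leqn0 -lam_m int_part_anti // (leq_trans le_mr).
by apply: min_m; rewrite lam0.
Qed.

(* The boxes (row, column), listed without repetition. *)
Definition young_diagram (lam : int_partition) : seq (nat * nat) :=
  [seq (i, j) | i <- iota 0 (nparts lam), j <- iota 0 (lam i)].

Lemma mem_young_diagram (lam : int_partition) (x : nat * nat) :
  (x \in young_diagram lam) = (x.2 < lam x.1).
Proof.
case: x => i j /=; apply/allpairsPdep/idP => [[i' [j' [_ + [-> ->]]]]|lt_j].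
  by rewrite mem_iota.
exists i, j; split; rewrite ?mem_iota //= add0n ltnNge.
by apply/negP => le_i; rewrite ((nparts_leP lam i).1 le_i) in lt_j.
Qed.

Lemma uniq_young_diagram (lam : int_partition) : uniq (young_diagram lam).
Proof.
apply: allpairs_uniq_dep => [|i _|[i j] [i' j'] _ _ /= [-> ->] //];
  exact: iota_uniq.
Qed.

(* [y] lies weakly to the right of [x] in its row, or weakly below it in its
   column. *)
Definition in_hook (x y : nat * nat) : bool :=
  (y.1 == x.1) && (x.2 <= y.2) || (y.2 == x.2) && (x.1 <= y.1).

Definition hook_length (lam : int_partition) (x : nat * nat) : nat :=
  count (in_hook x) (young_diagram lam).

Local Open Scope ring_scope.

(* A formal power series is given by its sequence of coefficients;
   [coefz f] extends this sequence by 0 to negative indices. *)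
Definition coefz (R : nzRingType) (f : nat -> R) (n : int) : R :=
  if n is Posz m then f m else 0.

(* Numbering rows and columns from 0 shifts i and j together, so that the entry
   is still the coefficient of index lambda_j - j + i. *)
Definition schur_det (R : comNzRingType) (r : nat) (lam : int_partition)
    (f : nat -> R) : R :=
  \det (\matrix_(i < r, j < r)
          coefz f ((lam j)%:Z - (j : nat)%:Z + (i : nat)%:Z)).

Definition exp_series (n : nat) : rat := n`!%:R^-1.

(* Main.v *)
(* Put l_i = lambda_i + r - 1 - i.  The boxes of row i have distinct hook
   lengths, none of which is a difference l_i - l_k with k > i, and together
   these numbers exhaust 1, ..., l_i; hence the hook lengths of row i have
   product l_i! / prod_(k > i) (l_i - l_k).  On the other side, after reversing
   rows and columns, the (i, j) entry of the Schur determinant is the falling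
   factorial of length i of m_j divided by m_j!, where m_j = l_(r - 1 - j);
   falling factorials are monic polynomials, so the determinant is the
   Vandermonde determinant of the m_j divided by prod_j m_j!. *)
Require Import Defs.
From HB Require Import structures.
From mathcomp Require Import all_boot all_order all_algebra.
From mathcomp Require Import perm zify.
Set Implicit Arguments.
Unset Strict Implicit.
Unset Printing Implicit Defensive.
Import GRing.Theory.
Local Open Scope ring_scope.

Lemma det_mxsub_perm (R : comNzRingType) n (s : 'S_n) (A : 'M[R]_n) :
  \det (mxsub s s A) = \det A.
Proof.
have -> : mxsub s s A = row_perm s (col_perm s A).
  by apply/matrixP => i j; rewrite !mxE.
rewrite row_permE col_permE !det_mulmx !det_perm odd_permV mulrC -mulrA.
by rewrite -signr_addb addbb mulr1.
Qed.

(** The coefficient matrix of the [p i] is lower triangular with unit diagonal, and multiplying it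
    by the Vandermonde matrix evaluates the polynomials. *)
Lemma det_monic_Vandermonde (R : comNzRingType) n (p : nat -> {poly R})
    (a : 'rV[R]_n) :
    (forall i, p i \is monic) -> (forall i, size (p i) = i.+1) ->
  \det (\matrix_(i < n, j < n) (p i).[a 0 j])
  = \prod_(i < n) \prod_(j < n | (i < j)%N) (a 0 j - a 0 i).
Proof.
move=> p_monic size_p; pose L : 'M[R]_n := \matrix_(i, k) (p i)`_k.
have -> : \matrix_(i < n, j < n) (p i).[a 0 j] = L *m Vandermonde n a.
  apply/matrixP => i j; rewrite !mxE (@horner_coef_wide _ n) ?size_p //.
  by apply: eq_bigr => k _; rewrite !mxE.
rewrite det_mulmx det_Vandermonde det_trig; last first.
  by apply/is_trig_mxP => i k lt_ik; rewrite mxE nth_default ?size_p.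
rewrite big1 ?mul1r // => i _; rewrite mxE.
by move/monicP: (p_monic i); rewrite lead_coefE size_p.
Qed.

Definition ffact_poly (R : nzRingType) (n : nat) : {poly R} :=
  \prod_(k <- iota 0 n) ('X - (k%:R)%:P).

Lemma horner_ffact_poly (R : comNzRingType) m n :
  (ffact_poly R n).[m%:R] = (m ^_ n)%:R.
Proof.
rewrite /ffact_poly; elim: n => [|n IHn]; first by rewrite big_nil hornerC.
rewrite -addn1 iotaD big_cat big_seq1 /= hornerM IHn hornerXsubC add0n addn1.
(* If [m < n], the subtraction [m - n] truncates, but [m ^_ n] already vanishes. *)
rewrite ffactnSr natrM; have [lt_mn|le_nm] := ltnP m n.
  by rewrite ffact_small // !mul0r.
by rewrite natrB.
Qed.

Lemma det_ffact (R : comNzRingType) n (m : 'I_n -> nat) :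
  \det (\matrix_(i < n, j < n) ((m j) ^_ i)%:R)
  = \prod_(i < n) \prod_(j < n | (i < j)%N) ((m j)%:R - (m i)%:R) :> R.
Proof.
transitivity (\det (\matrix_(i < n, j < n)
    (ffact_poly R i).[(\row_j (m j)%:R : 'rV[R]_n) 0 j])).
  by congr (\det _); apply/matrixP => i j; rewrite !mxE horner_ffact_poly.
rewrite det_monic_Vandermonde => [|i|i].
- by apply: eq_bigr => i _; apply: eq_bigr => j _; rewrite !mxE.
- exact: monic_prod_XsubC.
- by rewrite size_prod_XsubC size_iota.
Qed.

Section Partition.

Variable lam : int_partition.

Lemma conjugate_subproof c : exists k, (lam k <= c)%N.
Proof. by have [k /eqP lam_k] := int_part_vanishes lam; exists k; rewrite lam_k. Qed.

Definition conjugate c := ex_minn (conjugate_subproof c).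

Lemma ltn_conjugate c k : (k < conjugate c)%N = (c < lam k)%N.
Proof.
rewrite /conjugate; case: ex_minnP => m le_m min_m; apply/idP/idP => [lt_km|].
  by rewrite ltnNge; apply/negP => /min_m; rewrite leqNgt lt_km.
apply: contraTT; rewrite -!leqNgt => le_mk.
exact: leq_trans (int_part_anti lam le_mk) le_m.
Qed.

(** The hook is the disjoint union of the arm, here containing the corner, and the leg strictly
    below it; [conjugate c] is the length of column [c]. *)
Lemma hook_lengthE i c : (c < lam i)%N ->
  hook_length lam (i, c) = (lam i - c + (conjugate c - i.+1))%N.
Proof.
move=> lt_c; pose arm := [seq (i, j) | j <- iota c (lam i - c)].
pose leg := [seq (k, c) | k <- iota i.+1 (conjugate c - i.+1)].
suff /perm_size: perm_eq [seq x <- young_diagram lam | in_hook (i, c) x] (arm ++ leg).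
  by rewrite size_filter size_cat !size_map !size_iota.
apply: uniq_perm; first by rewrite filter_uniq ?uniq_young_diagram.
  rewrite cat_uniq !map_inj_uniq ?iota_uniq ?andbT //=; try by move=> ? ? [].
  apply/hasPn => _ /mapP[k + ->]; rewrite mem_iota => /andP[lt_ik _].
  by apply/mapP => -[j _ [eq_ki _]]; rewrite eq_ki ltnn in lt_ik.
case=> k j; rewrite mem_filter mem_young_diagram mem_cat /in_hook /=.
apply/andP/orP => [[/orP[/andP[/eqP -> le_cj]|/andP[/eqP -> le_ik]] lt_j]|].
- by left; apply/mapP; exists j; rewrite // mem_iota; lia.
- have [->|ne_ki] := eqVneq k i.
    by left; apply/mapP; exists c; rewrite // mem_iota; lia.
  right; apply/mapP; exists k => //; rewrite mem_iota.
  by move: lt_j; rewrite -ltn_conjugate; lia.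
- case=> /mapP[x + [-> ->]]; rewrite mem_iota => lt_x; first by lia.
  by split; [lia | rewrite -ltn_conjugate; lia].
Qed.

(** The second factors are the gaps l_i - l_k, arranged so that truncated subtraction is exact. *)
Lemma prod_hook_row r i : (nparts lam <= r)%N -> (i < r)%N ->
  ((\prod_(0 <= c < lam i) hook_length lam (i, c)) *
   \prod_(i.+1 <= k < r) (lam i + k - (lam k + i)) = (lam i + r.-1 - i)`!)%N.
Proof.
move=> le_r lt_ir; set l := (lam i + r.-1 - i)%N.
have conj_le c : (conjugate c <= r)%N.
  by rewrite leqNgt ltn_conjugate (nparts_leP lam r).1.
have conj_gt c : (c < lam i)%N -> (i < conjugate c)%N by rewrite ltn_conjugate.
pose hooks := [seq hook_length lam (i, c) | c <- index_iota 0 (lam i)].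
pose gaps := [seq (lam i + k - (lam k + i))%N | k <- index_iota i.+1 r].
have lamS k k' : (k <= k')%N -> (lam k' <= lam k)%N by exact: int_part_anti.
have conjS c c' : (c <= c')%N -> (conjugate c' <= conjugate c)%N.
  by move=> le_c; rewrite leqNgt ltn_conjugate -leqNgt (leq_trans _ le_c) //
    leqNgt -ltn_conjugate ltnn.
have uniq_all : uniq (hooks ++ gaps).
  rewrite cat_uniq !map_inj_in_uniq ?iota_uniq ?andbT /=.
  - apply/hasPn => _ /mapP[k + ->]; rewrite mem_index_iota => lt_k.
    apply/mapP => -[c]; rewrite mem_index_iota => /andP[_ lt_c].
    (* Equality would give [(lam k - c) + (conjugate c - k) = 1] over the integers, but by
       [ltn_conjugate] the two terms are both positive or both nonpositive. *)
    rewrite hook_lengthE //; have := conj_gt c lt_c.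
    have := ltn_conjugate c k; have := lamS i k; lia.
  (* Gaps strictly increase with [k]; below, hook lengths strictly decrease with [c]. *)
  - move=> k k'; rewrite !mem_index_iota => lt_k lt_k'.
    have := lamS k k'; have := lamS k' k; have := lamS i k; have := lamS i k'.
    lia.
  - move=> c c'; rewrite !mem_index_iota => /andP[_ lt_c] /andP[_ lt_c'].
    rewrite !hook_lengthE //; have := conj_gt c lt_c; have := conj_gt c' lt_c'.
    have := conjS c c'; have := conjS c' c; lia.
have sub_iota : {subset hooks ++ gaps <= index_iota 1 l.+1}.
  move=> x; rewrite mem_cat mem_index_iota => /orP[]/mapP[k];
    rewrite mem_index_iota => lt_k -> {x}.
  - by rewrite hook_lengthE; have := conj_le k; rewrite /l; lia.
  - by have := lamS i k; rewrite /l; lia.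
(* There are [lam i] hooks and [r - i - 1] gaps, [l] numbers in all, so they fill the interval. *)
have size_le : (size (index_iota 1 l.+1) <= size (hooks ++ gaps))%N.
  by rewrite size_cat !size_map !size_iota /l; lia.
have [_ eq_mem] := uniq_min_size uniq_all sub_iota size_le.
have perm_all : perm_eq (hooks ++ gaps) (index_iota 1 l.+1).
  by apply: uniq_perm; rewrite ?iota_uniq.
by rewrite fact_prod -(perm_big _ perm_all) big_cat !big_map.
Qed.

Lemma prod_young_diagram (R : comNzSemiRingType) r (F : nat * nat -> R) :
    (nparts lam <= r)%N ->
  \prod_(x <- young_diagram lam) F x
  = \prod_(i < r) \prod_(0 <= c < lam i) F (i : nat, c).
Proof.
move=> le_r; rewrite big_allpairs_dep.
rewrite -(big_mkord xpredT (fun i => \prod_(0 <= c < lam i) F (i, c))).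
rewrite (big_cat_nat (leq0n _) le_r) //= -[LHS]mulr1; congr (_ * _).
  by rewrite /index_iota subn0; apply: eq_bigr => i _; rewrite subn0.
rewrite big_nat big1 // => i /andP[le_i _].
by rewrite ((nparts_leP lam _).1 le_i) // big_geq.
Qed.

Lemma schur_det_exp r :
  schur_det r lam exp_series
  = \prod_(i < r) (((lam i + r.-1 - i)`!)%:R^-1 *
      \prod_(i.+1 <= k < r) (lam i + k - (lam k + i))%:R).
Proof.
pose m (j : 'I_r) := (lam (rev_ord j) + j)%N.
rewrite /schur_det -(det_mxsub_perm (perm (@rev_ord_inj r))).
set A := mxsub _ _ _.
have -> : A = (\matrix_(i < r, j < r) ((m j) ^_ i)%:R) *m
              diag_mx (\row_j ((m j)`!)%:R^-1).
  apply/matrixP => i j; rewrite mul_mx_diag !mxE !permE /m.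
  (* The reversed entry has index [n - i]. If it is negative, [coefz] and the falling factorial both
     vanish; otherwise 1/(n - i)! is [n ^_ i] divided by n!. *)
  set n := (_ + j)%N; have [lt_ni|le_in] := ltnP n i.
    rewrite ffact_small // mul0r.
    have -> : (lam (rev_ord j))%:Z - (rev_ord j : nat)%:Z + (rev_ord i : nat)%:Z
            = Negz (i - n).-1 by move: lt_ni (ltn_ord i) (ltn_ord j); rewrite /n /=; lia.
    by [].
  have -> : (lam (rev_ord j))%:Z - (rev_ord j : nat)%:Z + (rev_ord i : nat)%:Z
            = Posz (n - i) by move: le_in (ltn_ord i) (ltn_ord j); rewrite /n /=; lia.
  rewrite /= /exp_series -(ffact_fact le_in) natrM invfM mulrA divff ?mul1r //.
  by rewrite Num.Theory.pnatr_eq0 -lt0n ffact_gt0.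
rewrite det_mulmx det_ffact det_diag mulrC big_split; congr (_ * _).
  rewrite (reindex_inj rev_ord_inj) /=; apply: eq_bigr => i _.
  rewrite mxE /m rev_ordK /=; congr (_`!%:R^-1); have := ltn_ord i; lia.
(* Reversing both indices turns m back into l and i < j into j < i; exchanging the products then
   puts the smaller index outside. *)
rewrite (reindex_inj rev_ord_inj) /=.
under eq_bigr => i _ do rewrite (reindex_inj rev_ord_inj) /=.
rewrite (exchange_big_dep xpredT) //=; apply: eq_bigr => i _.
rewrite big_geq_mkord; apply: eq_big => [k|k lt_ik] /=.
  by have := ltn_ord i; have := ltn_ord k; lia.
have := ltn_ord i; have := ltn_ord k; have := int_part_anti lam (i := i) (j := k).
by rewrite /m !rev_ordK /= => *; rewrite -natrB; [congr (_%:R); lia | lia].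
Qed.

End Partition.

Theorem corollary3p4 (lam : int_partition) (r : nat) (hr : (nparts lam <= r)%N) :
  \prod_(x <- young_diagram lam) (hook_length lam x)%:R
  = 1 / schur_det r lam exp_series :> rat.
Proof.
rewrite (prod_young_diagram _ hr) schur_det_exp div1r -prodfV.
apply: eq_bigr => i _; rewrite -(prod_hook_row hr (ltn_ord i)) natrM !natr_prod.
(* The gaps cancel because l_i > l_k whenever k > i. *)
rewrite invfM invrK mulfK // prodf_seq_neq0.
apply/allP => k; rewrite mem_index_iota => /andP[lt_ik _].
rewrite Num.Theory.pnatr_eq0; have := int_part_anti lam (ltnW lt_ik); lia.
Qed.
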